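(* Let $(X,\mathcal{A},\mu,T)$ be an ergodic probability preserving system, $(A_l)$ an asymptotically rare sequence in $\mathcal{A}$, and $(\psi_{A_l})_{l\ge1}$ a sequence of $\mathfrak{F}$-valued local observables for the $A_l$, with corresponding local processes $\Psi_{A_l}$. Let $(\nu_l)$ be a sequence in $\mathfrak{P}$. Assume there are measurable $\tau_l:X\to\mathbb{N}_0$ such that $\nu_l(\tau_l<\varphi_{A_l})\to1$ as $l\to\infty$, while there is a compact subset $\mathfrak{K}$ of $(\mathfrak{P},d_{\mathfrak{P}})$ with $T^{\tau_l}_\ast\nu_l\in\mathfrak{K}$ for $l\ge1$. Then for any random sequence $\Psi$ in $\mathfrak{F}$, $$\Psi_{A_l}\overset{\nu_l}{\Longrightarrow}\Psi\quad\text{iff}\quad\Psi_{A_l}\overset{\mu}{\Longrightarrow}\Psi\qquad\text{as }l\to\infty.$$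
   Context: $(\mathfrak{F},d_{\mathfrak{F}})$ is a compact metric space. $T$ ergodic and preserving the probability $\mu$. For $A$ with $\mu(A)>0$: $\varphi_A(x):=\inf\{n\ge1:T^nx\in A\}$, $T_Ax:=T^{\varphi_A(x)}x$. Asymptotically rare: $0<\mu(A_l)\to0$. A local observable on $A$ is a measurable $\psi_A:A\to\mathfrak{F}$; its local process is $\Psi_A:=(\psi_A\circ T_A,\psi_A\circ T_A^2,\ldots):X\to\mathfrak{F}^{\mathbb{N}}$ (product topology). $\mathfrak{P}$: probabilities $\nu\ll\mu$ with $d_{\mathfrak{P}}(\nu,\nu')=2\sup_A|\nu(A)-\nu'(A)|$. $T^\tau x:=T^{\tau(x)}x$, $T^\tau_\ast\nu:=\nu\circ(T^\tau)^{-1}$. $\overset{\nu}{\Longrightarrow}$ means weak convergence of laws under $\nu$. *)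

(* Defs.v *)
From HB Require Import structures.
From mathcomp Require Import all_boot all_order all_algebra.
From mathcomp Require Import all_classical all_reals all_analysis.
Set Implicit Arguments. Unset Strict Implicit. Unset Printing Implicit Defensive.
Import Order.TTheory GRing.Theory Num.Theory.
Import numFieldNormedType.Exports.
Local Open Scope classical_set_scope.
Local Open Scope ring_scope.

Section Defs.
Context {R : realType} {d : measure_display} {X : measurableType d}.

Definition measure_preserving (mu : probability X R) (T : X -> X) :=
  measurable_fun setT T /\
  forall A, measurable A -> mu (T @^-1` A) = mu A.

Definition ergodic (mu : probability X R) (T : X -> X) :=
  forall A, measurable A -> T @^-1` A = A -> mu A = 0%E \/ mu A = 1%E.

Definition abs_cont (nu mu : probability X R) :=
  forall A, measurable A -> mu A = 0%E -> nu A = 0%E.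

Definition dP (nu nu' : probability X R) : \bar R :=
  (2%:E * ereal_sup [set `|nu A - nu' A|%E | A in measurable])%E.

(* open subsets of (P, d_P) (relative to P = {nu | nu << mu}) *)
Definition Popen (mu : probability X R) (U : set (probability X R)) :=
  forall nu, U nu -> abs_cont nu mu ->
    exists2 e : R, 0 < e &
      forall nu', abs_cont nu' mu -> (dP nu nu' < e%:E)%E -> U nu'.

Definition Pcompact (mu : probability X R) (K : set (probability X R)) :=
  (forall nu, K nu -> abs_cont nu mu) /\
  forall (I : Type) (U : I -> set (probability X R)),
    (forall i, Popen mu (U i)) -> K `<=` \bigcup_i U i ->
    exists2 J : set I, finite_set J & K `<=` \bigcup_(i in J) U i.

(* first return time, as a natural number (0 if x never enters A) *)
Definition first_return (T : X -> X) (A : set X) (x : X) : nat :=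
  match pselect (exists n, (0 < n)%N && `[< A (iter n T x) >]) with
  | left h => ex_minn h
  | right _ => 0%N
  end.

Definition phi (T : X -> X) (A : set X) (x : X) : \bar R :=
  if `[< exists n, (0 < n)%N && `[< A (iter n T x) >] >]
  then ((first_return T A x)%:R)%:E else +oo%E.

(* first return map T_A x = T^{phi_A x} x (convention T_A x = x if phi_A x = oo) *)
Definition TA (T : X -> X) (A : set X) (x : X) : X :=
  iter (first_return T A x) T x.

Definition Ttau (T : X -> X) (tau : X -> nat) (x : X) : X := iter (tau x) T x.

Definition local_process {F : Type} (T : X -> X) (A : set X) (psi : X -> F)
  (x : X) : {ptws nat -> F} := fun j => psi (iter j.+1 (TA T A) x).

End Defs.

Definition borel_meas_on {d} {X : measurableType d} {F : topologicalType}
  (D : set X) (f : X -> F) :=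
  forall U : set F, open U -> measurable (D `&` f @^-1` U).

Definition weak_cvg_law {R : realType} {d} {X : measurableType d}
  {dO} {Om : measurableType dO} {F : topologicalType}
  (nu : nat -> probability X R) (Z : nat -> X -> {ptws nat -> F})
  (P : probability Om R) (Psi : Om -> {ptws nat -> F}) :=
  forall f : {ptws nat -> F} -> R, continuous f ->
    (exists M : R, forall z, `|f z| <= M) ->
    (fun l => Rintegral (nu l) setT (f \o Z l)) @ \oo -->
      Rintegral P setT (f \o Psi).

(* Main.v *)
Require Import Defs.
From HB Require Import structures.
From mathcomp Require Import all_boot all_order all_algebra.
From mathcomp Require Import all_classical all_reals all_analysis.
From mathcomp Require Import measurable_realfun ring lra.
Set Implicit Arguments. Unset Strict Implicit. Unset Printing Implicit Defensive.
Import Order.TTheory GRing.Theory Num.Theory.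
Import numFieldNormedType.Exports.
Local Open Scope classical_set_scope.
Local Open Scope ring_scope.

(** Write [g l] for a bounded continuous function of the local process of [A l].
    As long as the orbit of [x] has not met [A l] up to time [t], the first
    return map takes the same value at [x] and at [T^t x], hence so does [g l].
    With [t = tau l x] this replaces [nu l] by its image under [T^(tau l)], which
    lies in [K]; with [t = 1] it shows that [g l \o T = g l] off the small set
    [T^-1 (A l)].  Along any ultrafilter the set function
    [B |-> int_B g l dmu - mu B * int g l dmu] converges to a [T]-invariant charge
    dominated by [mu] of total mass 0, and such a charge vanishes by ergodicity.
    Approximating densities by simple functions, [int g l dk - int g l dmu]
    tends to 0 for every [k << mu], and uniformly on the compact [K] because
    integrals of bounded functions are Lipschitz for the total variation. *)

(** * Recurrence and ergodicity *)

Section recurrence.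
Context {R : realType} {d : measure_display} {X : measurableType d}.
Variables (mu : probability X R) (T : X -> X).
Hypothesis muT : measure_preserving mu T.

Lemma measurable_iter n : measurable_fun setT (iter n T).
Proof.
elim: n => [|n IH]; first exact: measurable_id.
by rewrite (_ : iter n.+1 T = T \o iter n T)//; apply: measurableT_comp IH; case: muT.
Qed.

Lemma measurable_preimage_iter n (A : set X) :
  measurable A -> measurable (iter n T @^-1` A).
Proof. by move=> mA; rewrite -[X in measurable X]setTI; exact: measurable_iter. Qed.

Lemma measure_preimage_iter n (A : set X) :
  measurable A -> mu (iter n T @^-1` A) = mu A.
Proof.
move=> mA; elim: n => [//|n IH]; rewrite -[RHS]IH.
rewrite -(muT.2 _ (measurable_preimage_iter n mA)); congr (mu _).
by apply/seteqP; split => x /=; rewrite -iterSr.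
Qed.

(** Infinitely many visits, rather than at least one, make the set strictly invariant, as [ergodic]
    requires, and stable under the return map. *)
Definition recurrent (A : set X) := lim_sup_set (fun k => iter k T @^-1` A).

Lemma recurrentP (A : set X) x :
  recurrent A x <-> forall n, exists2 k, (n <= k)%N & A (iter k T x).
Proof. by split=> [h n|h n _]; [have [k] := h n I|have [k] := h n]; exists k. Qed.

Lemma recurrent_step (A : set X) x : recurrent A (T x) <-> recurrent A x.
Proof.
split=> /recurrentP h; apply/recurrentP => n.
  by have [k nk] := h n; rewrite -iterSr => ?; exists k.+1 => //; exact: ltnW.
have [[//|k] nk Ak] := h n.+1.
by exists k => //; rewrite -iterSr.
Qed.

Lemma recurrent_iter (A : set X) k x : recurrent A (iter k T x) <-> recurrent A x.
Proof.
by elim: k => //= k IH; split => [/recurrent_step/IH//|h]; apply/recurrent_step/IH.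
Qed.

Lemma preimage_recurrent (A : set X) : T @^-1` recurrent A = recurrent A.
Proof. by apply/seteqP; split => x h; apply/recurrent_step. Qed.

Lemma measurable_recurrent (A : set X) : measurable A -> measurable (recurrent A).
Proof.
move=> mA; apply: bigcap_measurable => // k _.
by apply: bigcup_measurable => j _; exact: measurable_preimage_iter.
Qed.

(** Strict invariance leaves only the values 0 and 1. The unions of the preimages from time [n] on
    decrease to the set, and each contains a preimage of [A] of the same measure as [A], so the
    value 0 would contradict [0 < mu A]. *)
Lemma measure_recurrent (A : set X) : ergodic mu T -> measurable A ->
  (0 < mu A)%E -> mu (recurrent A) = 1%E.
Proof.
move=> ergT mA A0.
have mQ k : measurable (iter k T @^-1` A) by exact: measurable_preimage_iter.
have mU n : measurable (\bigcup_(k >= n) (iter k T @^-1` A)).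
  exact: bigcup_measurable.
have [r0|//] := ergT _ (measurable_recurrent mA) (preimage_recurrent A).
have cv := lim_sup_set_cvg mu _ mQ.
have /cv{}cv : (mu (\bigcup_(k >= 0) (iter k T @^-1` A)) < +oo)%E.
  by rewrite ltey_eq fin_num_measure.
have : (mu A <= mu (recurrent A))%E.
  apply: (cvge_ge _ cv) => //; apply: nearW => n.
  rewrite -(measure_preimage_iter n mA) le_measure ?inE//.
  by move=> x Ax; exists n => /=.
by rewrite r0 leNgt A0.
Qed.

(* Every T-preimage of a Hahn positive set P is again a maximal set for the
   charge, so the strictly invariant set limsup T^-k P is one too. *)
Lemma invariant_charge_eq0 (s : {charge set X -> \bar R}) :
  ergodic mu T ->
  (forall B, measurable B -> mu B = 0 -> s B = 0)%E ->
  (forall B, measurable B -> s (T @^-1` B) = s B) ->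
  s setT = 0%E -> forall B, measurable B -> s B = 0%E.
Proof.
move=> ergT smu sT s0.
have [P [N PN]] := Hahn_decomposition s.
have mP : measurable P by case: PN => -[].
pose jp : {measure set X -> \bar R} := jordan_pos PN.
pose jn : {measure set X -> \bar R} := jordan_neg PN.
have sE B : measurable B -> s B = (jp B - jn B)%E.
  by move=> mB; rewrite (jordan_decomp PN mB) /cadd /= cscaleN1.
have fp B : measurable B -> jp B \is a fin_num.
  by move=> mB; exact: (fin_num_measure (jordan_pos PN)).
have fn B : measurable B -> jn B \is a fin_num.
  by move=> mB; exact: (fin_num_measure (jordan_neg PN)).
pose Q k := iter k T @^-1` P.
have mQ k : measurable (Q k) by exact: measurable_preimage_iter.
have sQ k : s (Q k) = s P.
  elim: k => [//|k <-]; rewrite -(sT _ (mQ k)); congr (s _).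
  by apply/seteqP; split => x; rewrite /Q /= -iterSr.
(* A Hahn positive set carries the whole positive part. *)
have sP : s P = jp setT.
  rewrite sE//; have -> : jn P = 0%E.
    rewrite -[jn P]/(jordan_neg PN P) jordan_negE cjordan_negE /crestr0 mem_set// /crestr.
    by have [_ _ _ ->] := PN; rewrite charge0 oppe0.
  rewrite sube0 -[jp P]/(jordan_pos PN P) -[jp setT]/(jordan_pos PN setT).
  rewrite !jordan_posE !cjordan_posE /crestr0 !mem_set// /crestr.
  by rewrite setIid setTI.
(* The charge of [Q k] attains the maximum [jp setT], which leaves no negative mass inside [Q k] and
   no positive mass outside it. *)
have null k : jn (Q k) = 0%E /\ jp (~` Q k) = 0%E.
  have mQC : measurable (~` Q k) by exact: measurableC.
  have : jp setT = (jp (Q k) + jp (~` Q k))%E.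
    by rewrite -measureU ?setUCr ?setICr.
  rewrite -sP -(sQ k) sE// => /eqP.
  have : (0 <= jn (Q k))%E by [].
  have : (0 <= jp (~` Q k))%E by [].
  rewrite -(fineK (fp _ (mQ k))) -(fineK (fp _ mQC)) -(fineK (fn _ (mQ k))).
  move: (fine _) (fine _) (fine _) => a b c.
  rewrite !lee_fin -EFinB -EFinD => a0 b0 /eqP[e].
  by split; congr (_%:E); lra.
pose L := recurrent P.
have mL : measurable L by exact: measurable_recurrent.
have mLC : measurable (~` L) by exact: measurableC.
(* Countable unions of null sets: [L] lies in the union of the [Q k], and its complement in the
   union of their complements. *)
have jnL : jn L = 0%E.
  apply/eqP; rewrite eq_le measure_ge0 andbT.
  have <- : jn (\bigcup_k Q k) = 0%E.
    apply/negligibleP; first exact: bigcup_measurable.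
    apply: negligible_bigcup => k; apply/negligibleP => //.
    by case: (null k).
  rewrite le_measure ?inE//; first exact: bigcup_measurable.
  by move=> x /recurrentP/(_ 0%N)[k _ ?]; exists k.
have jpL : jp (~` L) = 0%E.
  apply/eqP; rewrite eq_le measure_ge0 andbT.
  have <- : jp (\bigcup_k ~` Q k) = 0%E.
    apply/negligibleP.
      by apply: bigcup_measurable => k _; exact: measurableC.
    apply: negligible_bigcup => k; apply/negligibleP; first exact: measurableC.
    by case: (null k).
  rewrite le_measure ?inE//.
    by apply: bigcup_measurable => k _; exact: measurableC.
  move=> x Lx; apply: contrapT => h; apply: Lx; apply/recurrentP => n.
  by exists n => //; apply: contrapT => Qn; apply: h; exists n.
have jpT : jp setT = jp L.
  have : jp setT = (jp L + jp (~` L))%E by rewrite -measureU ?setUCr ?setICr.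
  by rewrite jpL adde0.
(* Ergodicity makes [L] or its complement [mu]-null; domination and the zero total charge give
   [s L = 0] in both cases, and this value is also [jp setT]. *)
have sL : s L = 0%E.
  have [m0|m1] := ergT _ mL (preimage_recurrent P); first exact: smu.
  have : mu (~` L) = 0%E by rewrite probability_setC// m1 subee.
  move/(smu _ mLC) => sLC; have : s setT = (s L + s (~` L))%E.
    by rewrite -chargeU ?setUCr ?setICr.
  by rewrite s0 sLC adde0.
have jpT0 : jp setT = 0%E by rewrite jpT; move: sL; rewrite sE// jnL sube0.
have jnT0 : jn setT = 0%E.
  by move: s0; rewrite sE// jpT0 sub0e => /eqP; rewrite oppe_eq0 => /eqP.
move=> B mB; rewrite sE//.
have -> : jp B = 0%E.
  by apply/eqP; rewrite eq_le measure_ge0 andbT -jpT0 le_measure ?inE.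
have -> : jn B = 0%E.
  by apply/eqP; rewrite eq_le measure_ge0 andbT -jnT0 le_measure ?inE.
by rewrite subee.
Qed.

End recurrence.

(** * Integrals of bounded functions *)

Section bounded_integral.
Context {R : realType} {d : measure_display} {X : measurableType d}.
Variable k : {finite_measure set X -> \bar R}.
Implicit Types (B E : set X) (f g : X -> R) (M : R).

Lemma bounded_integrable B g M : measurable B -> measurable_fun setT g ->
  (forall x, `|g x| <= M) -> k.-integrable B (EFin \o g).
Proof.
move=> mB mg gM; apply: measurable_bounded_integrable => //.
- by rewrite ltey_eq fin_num_measure.
- exact: measurable_funTS.
- exists M; split; first exact: num_real.
  by move=> y My x _; exact: le_trans (gM x) (ltW My).
Qed.

Lemma le_norm_bounded_Rintegral B g M : measurable B -> measurable_fun setT g ->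
  (forall x, `|g x| <= M) -> `|Rintegral k B g| <= M * fine (k B).
Proof.
move=> mB mg gM; rewrite -Rintegral_cst//.
apply: le_trans (le_normr_Rintegral mB (bounded_integrable mB mg gM)) _.
(* The sign of [M] is read off at a point, hence the dependence on [x]. *)
have M0 (x : X) : 0 <= M by exact: le_trans (gM x).
apply: le_Rintegral => //.
- apply: (@bounded_integrable _ _ M) => //; last by move=> x; rewrite normr_id.
  exact: measurableT_comp.
- apply: (@bounded_integrable _ _ M) => //.
  by move=> x; rewrite ger0_norm ?M0.
Qed.

(** The difference vanishes off [E] and is at most [2 * M] on it. *)
Lemma le_dist_Rintegral_off B E f g M : measurable B -> measurable E ->
  measurable_fun setT f -> measurable_fun setT g ->
  0 <= M -> (forall x, `|f x| <= M) -> (forall x, `|g x| <= M) ->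
  (forall x, ~ E x -> f x = g x) ->
  `|Rintegral k B f - Rintegral k B g| <= 2 * M * fine (k E).
Proof.
move=> mB mE mf mg M0 fM gM fg.
have fgM x : `|f x - g x| <= 2 * M.
  by apply: le_trans (ler_normB _ _) _; have := fM x; have := gM x; lra.
have mfg : measurable_fun setT (fun x => f x - g x) by exact: measurable_funB.
rewrite -RintegralB//; [|exact: bounded_integrable fM|exact: bounded_integrable gM].
rewrite (_ : Rintegral k B _ = Rintegral k (B `&` E) (fun x => f x - g x)).
  apply: le_trans (le_norm_bounded_Rintegral _ mfg fgM) _; first exact: measurableI.
  rewrite ler_wpM2l ?mulr_ge0// fine_le ?fin_num_measure//; first exact: measurableI.
  by rewrite le_measure ?inE//; exact: measurableI.
rewrite Rintegral_mkcondr; apply: eq_Rintegral => x _.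
by rewrite patchE; case: ifPn => // /negP Ex; rewrite fg ?subrr// => ?; apply: Ex; rewrite inE.
Qed.

End bounded_integral.

(** * Charges as ultrafilter limits *)

Lemma squeeze_norm0 {R : realType} (u v : nat -> R) :
  (forall n, `|u n| <= v n) -> v @ \oo --> 0 -> u @ \oo --> 0.
Proof.
move=> uv v0; apply/norm_cvg0P.
apply: (@squeeze_cvgr _ _ _ _ (fun=> 0) v) => //; last exact: cvg_cst.
by apply: nearW => n; rewrite normr_ge0/=.
Qed.

Section ultra_limits.
Context {R : realType}.
Implicit Types (u : nat -> R) (U : set_system nat).

(** The image of the ultrafilter has a cluster point in a compact interval, and an ultrafilter
    converges to each of its cluster points. *)
Lemma bounded_ultra_cvg U u (C : R) : UltraFilter U -> (forall l, `|u l| <= C) ->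
  exists p : R, u @ U --> p.
Proof.
move=> UU uC.
have cK := @segment_compact R (- C) C.
have FU : ProperFilter U by exact: ultra_proper.
have [|p [_ clp]] := cK (u @ U) _.
  suff : U (u @^-1` `[- C, C]) by [].
  by apply: filterE => l /=; rewrite in_itv/= -ler_norml.
exists p => V Vp.
have [//|UC] := in_ultra_setVsetC (u @^-1` V) UU.
by have [q [h ?]] := clp (~` V) V UC Vp.
Qed.

(** Limits at infinity can be tested along ultrafilters, where bounded sequences always converge. *)
Lemma cvg_ultra u (p : R) :
  (forall U, UltraFilter U -> \oo `<=` U -> u @ U --> p) -> u @ \oo --> p.
Proof.
move=> h V Vp; apply: contrapT => nV.
(* If [V] is missed infinitely often, the traces of the tails on the indices with [u n] outside [V]
   generate a proper filter; an ultrafilter above it contradicts convergence to [p]. *)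
pose G : set_system nat := [set S | \forall n \near \oo, ~ V (u n) -> S n].
have GF : ProperFilter G.
  split.
    move=> G0; have {}G0 : \forall n \near \oo, ~ V (u n) -> False := G0.
    apply: nV; suff : \forall n \near \oo, V (u n) by [].
    by near=> n; apply: contrapT; near: n.
  split.
  - exact: nearW.
  - move=> P Q; rewrite /G/= => GP GQ; near=> n => nV'.
    by split; [exact: (near GP n)|exact: (near GQ n)].
  - move=> P Q PQ; rewrite /G/= => GP; near=> n => nV'.
    by apply: PQ; exact: (near GP n).
have [U [UU GU]] := ultraFilterLemma GF.
have oU : \oo `<=` U by move=> P oP; apply: GU; apply: filterS oP.
have UV : U (u @^-1` V) by exact: (h U UU oU).
have UC : U (~` (u @^-1` V)) by apply: GU; exact: nearW.
have PU : ProperFilter U by exact: ultra_proper.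
by have /filter_ex[n []] : U (u @^-1` V `&` ~` (u @^-1` V)) by exact: filterI.
Unshelve. all: by end_near. Qed.

End ultra_limits.

Section dominated_charge.
Context {R : realType} {d : measure_display} {X : measurableType d}.
Variable mu : {finite_measure set X -> \bar R}.

(** Domination upgrades finite additivity to countable additivity: what remains of a disjoint union
    after [n] terms has [mu]-measure tending to 0. *)
Lemma dominated_additive_charge (s : set X -> R) (C : R) :
  (forall B, measurable B -> `|s B| <= C * fine (mu B)) ->
  (forall A B, measurable A -> measurable B -> A `&` B = set0 ->
    s (A `|` B) = s A + s B) ->
  exists c : {charge set X -> \bar R}, forall B, c B = (s B)%:E.
Proof.
move=> sC sU.
pose c B := (s B)%:E.
have s0 : s set0 = 0.
  by have := sC _ measurable0; rewrite measure0 mulr0 normr_le0 => /eqP.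
have c0 : c set0 = 0%E by rewrite /c s0.
have cfin B : measurable B -> c B \is a fin_num by [].
have csig : semi_sigma_additive c.
  move=> F mF tF mUF; pose U n := \big[setU/set0]_(i < n) F i.
  have mU n : measurable (U n) by exact: bigsetU_measurable.
  have UF n : U n `<=` \bigcup_i F i.
    by rewrite /U -bigcup_mkord => x [i _ Fi]; exists i.
  have sUn n : \sum_(0 <= i < n) s (F i) = s (U n).
    rewrite big_mkord /U; elim: n => [|n IH]; first by rewrite !big_ord0 s0.
    rewrite !big_ord_recr/= IH sU//; first exact: mU.
    rewrite -bigcup_mkord -subset0 => x [[i /= ni Fi] Fn].
    have ij : i = n by apply: (tF i n I I); exists x.
    by move: ni; rewrite ij ltnn.
  have cvU : fine (mu (U n)) @[n --> \oo] --> fine (mu (\bigcup_i F i)).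
    apply: fine_cvg; rewrite fineK ?fin_num_measure//.
    rewrite (_ : \bigcup_i F i = \bigcup_n U n); last first.
      apply/seteqP; split => [x [i _ Fi]|x [n _ /UF//]].
      by exists i.+1 => //; rewrite /U big_ord_recr; right.
    apply: nondecreasing_cvg_mu => //; first exact: bigcup_measurable.
    by move=> m n mn; exact/subsetPset/subset_bigsetU.
  rewrite (_ : (fun n => _) = (fun n => (s (U n))%:E)); last first.
    by apply/funext => n; rewrite -sUn sumEFin.
  apply: cvg_EFin; first exact: nearW.
  rewrite /= (_ : _ \o _ = (fun n => s (U n)))//.
  have dU n : s (\bigcup_i F i) = s (U n) + s (\bigcup_i F i `\` U n).
    rewrite -sU ?setDUK//; first exact: measurableD.
    by rewrite setDE setICA setICr setI0.
  have mud n : fine (mu (\bigcup_i F i `\` U n)) =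
      fine (mu (\bigcup_i F i)) - fine (mu (U n)).
    by rewrite measureD ?setIidr// ?fineB ?fin_num_measure// ltey_eq fin_num_measure.
  apply/subr_cvg0; apply: (@squeeze_norm0 _ _
    (fun n => C * (fine (mu (\bigcup_i F i)) - fine (mu (U n))))).
  - move=> n; rewrite [X in _ - X](dU n) opprD addNKr normrN.
    by rewrite -mud; apply: sC; exact: measurableD.
  - rewrite -[X in _ --> X](mulr0 C) -(subrr (fine (mu (\bigcup_i F i)))).
    by apply: cvgMl_tmp; apply: cvgB => //; exact: cvg_cst.
pose cc : {charge set X -> \bar R} := HB.pack c (isCharge.Build _ _ _ c c0 cfin csig).
by exists cc.
Qed.

End dominated_charge.

(** * Asymptotically invariant functions are asymptotically constant *)

Section asymptotically_invariant.
Context {R : realType} {d : measure_display} {X : measurableType d}.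
Variables (mu : probability X R) (T : X -> X).
Hypotheses (muT : measure_preserving mu T) (ergT : ergodic mu T).
Variables (g : nat -> X -> R) (M : R) (E : nat -> set X).
Hypotheses (mg : forall l, measurable_fun setT (g l))
  (gM : forall l x, `|g l x| <= M)
  (mE : forall l, measurable (E l))
  (E0 : fine (mu (E l)) @[l --> \oo] --> 0)
  (gT : forall l x, ~ E l x -> g l (T x) = g l x).

(** The covariance under [mu] of [g l] and the indicator of [B]. *)
Let s l B := Rintegral mu B (g l) - fine (mu B) * Rintegral mu setT (g l).

Let mu1 : fine (mu setT) = 1. Proof. by rewrite probability_setT. Qed.

Let igM l : `|Rintegral mu setT (g l)| <= M.
Proof. by rewrite -[M]mulr1 -mu1; exact: le_norm_bounded_Rintegral. Qed.

Let M0 : 0 <= M. Proof. exact: le_trans (igM 0%N). Qed.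

Let s_bound l B : measurable B -> `|s l B| <= 2 * M * fine (mu B).
Proof.
move=> mB; have b0 : 0 <= fine (mu B) by rewrite fine_ge0.
apply: le_trans (ler_normB _ _) _.
have := le_norm_bounded_Rintegral mu mB (mg l) (gM l).
have : `|fine (mu B) * Rintegral mu setT (g l)| <= fine (mu B) * M.
  by rewrite normrM (ger0_norm b0) ler_wpM2l.
nra.
Qed.

Let s_add l A B : measurable A -> measurable B -> A `&` B = set0 ->
  s l (A `|` B) = s l A + s l B.
Proof.
move=> mA mB AB; rewrite /s Rintegral_setU//; last 2 first.
- by apply: bounded_integrable (gM l) => //; exact: measurableU.
- by apply/disj_setPS; rewrite AB.
by rewrite measureU// fineD ?fin_num_measure//; ring.
Qed.

(** By invariance of [mu] the terms in [mu B] cancel, and the integral of [g l] over [B] becomes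
    that of [g l \o T] over the preimage of [B]; the integrands [g l] and [g l \o T] differ only on
    [E l]. *)
Let s_inv l B : measurable B ->
  `|s l (T @^-1` B) - s l B| <= 2 * M * fine (mu (E l)).
Proof.
move=> mB; have mT : measurable_fun setT T by case: muT.
have mTB : measurable (T @^-1` B) by rewrite -[X in measurable X]setTI; exact: mT.
have mgT : measurable_fun setT (g l \o T) by exact: measurableT_comp.
have gTM x : `|(g l \o T) x| <= M by exact: gM.
have -> : s l (T @^-1` B) - s l B =
    Rintegral mu (T @^-1` B) (g l) - Rintegral mu (T @^-1` B) (g l \o T).
  rewrite /s muT.2// opprB addrA subrK; congr (_ - _).
  rewrite /Rintegral; congr fine.
  rewrite (eq_measure_integral (pushforward mu T)); last first.
    by move=> C mC _; exact/esym/muT.2.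
  rewrite integral_pushforward//; first by apply/measurable_EFinP; exact: mg.
  exact: (bounded_integrable mu mTB mgT gTM).
apply: le_dist_Rintegral_off => // x Ex; exact/esym/gT.
Qed.

Lemma asymp_invariant_indic B : measurable B -> s l B @[l --> \oo] --> 0.
Proof.
move=> mB; apply: cvg_ultra => U UU oU.
have FU : ProperFilter U by exact: ultra_proper.
(* One ultrafilter serves every measurable set, so that the limits inherit additivity and
   invariance; 0 is a default value on nonmeasurable sets. *)
have /choice[t tP] : forall C : set X,
    exists t : R, measurable C -> (fun l => s l C) @ U --> t.
  move=> C.
  have [mC|nC] := pselect (measurable C); last by exists 0.
  have [p sp] := bounded_ultra_cvg UU (fun l => s_bound l mC).
  by exists p.
have tC C : measurable C -> `|t C| <= 2 * M * fine (mu C).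
  move=> mC; apply: (cvgr_to_le (cvg_norm (tP C mC))).
  by apply: filterE => l /=; exact: s_bound.
have tU A C : measurable A -> measurable C -> A `&` C = set0 ->
    t (A `|` C) = t A + t C.
  move=> mA mC AC; have mAC : measurable (A `|` C) by exact: measurableU.
  apply: (cvg_unique _ (tP _ mAC)) => //.
  rewrite (_ : (fun l => _) = (fun l => s l A + s l C)); last first.
    by apply/funext => l; rewrite s_add.
  by apply: cvgD; exact: tP.
have [c cE] := dominated_additive_charge tC tU.
suff : c B = 0%E by rewrite cE => -[<-]; exact: tP.
apply: (invariant_charge_eq0 muT ergT _ _ _ mB).
- move=> C mC C0; rewrite cE; congr EFin.
  by have := tC C mC; rewrite C0 mulr0 normr_le0 => /eqP.
- move=> C mC; rewrite !cE; congr EFin.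
  have mT : measurable_fun setT T by case: muT.
  have mTC : measurable (T @^-1` C) by rewrite -[X in measurable X]setTI; exact: mT.
  apply/eqP; rewrite -subr_eq0; apply/eqP.
  apply: (cvg_unique _ (cvgB (tP _ mTC) (tP _ mC))) => //.
  (* The invariance defect tends to 0 at infinity, hence along the finer filter [U]. *)
  apply: cvg_trans (_ : (fun l => s l (T @^-1` C) - s l C) @ \oo --> 0).
    by move=> V oV; exact: oU.
  apply: (@squeeze_norm0 _ _ (fun l => 2 * M * fine (mu (E l)))).
  + by move=> l; exact: s_inv.
  + by rewrite -[X in _ --> X](mulr0 (2 * M)); exact: cvgMl_tmp.
- rewrite cE; congr EFin; apply: (cvg_unique _ (tP _ measurableT)) => //.
  rewrite (_ : (fun l => _) = (fun l => 0)); first exact: cvg_cst.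
  by apply/funext => l; rewrite /s mu1 mul1r subrr.
Qed.

(** Asymptotic decorrelation from the test function [h]. Measurability and boundedness are carried
    along because the step to sums needs the products with [g l] to be integrable. *)
Let decoupled (h : X -> R) := [/\ measurable_fun setT h,
  (exists C : R, forall x, `|h x| <= C) &
  Rintegral mu setT (fun x => g l x * h x) -
  Rintegral mu setT (g l) * Rintegral mu setT h @[l --> \oo] --> (0 : R)].

Let gh_integrable l (h : X -> R) : measurable_fun setT h -> (exists C : R, forall x, `|h x| <= C) ->
  mu.-integrable setT (EFin \o (fun x => g l x * h x)).
Proof.
move=> mh [C hC]; apply: (@bounded_integrable _ _ _ _ _ _ (M * C)) => //.
  exact: measurable_funM.
by move=> x; rewrite normrM ler_pM.
Qed.

Let decoupled_indic (a : R) B : measurable B -> decoupled (fun x => a * \1_B x).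
Proof.
move=> mB.
have m1 : measurable_fun setT (fun x : X => a * \1_B x : R).
  by apply: measurable_funM => //; exact: measurable_indic.
split => //.
  exists `|a| => x; rewrite normrM ler_piMr// indicE.
  by case: (_ \in _); rewrite ?normr0 ?normr1.
rewrite (_ : (fun l => _) = (fun l => a * s l B)).
  by rewrite -[X in _ --> X](mulr0 a); apply: cvgMl_tmp; exact: asymp_invariant_indic.
apply/funext => l.
have -> : (fun x => g l x * (a * \1_B x)) = (fun x => a * (g l \_ B) x).
  by apply/funext => x; rewrite mulrCA patch_indic.
have -> : (fun x : X => a * \1_B x : R) = ((cst a) \_ B).
  by apply/funext => x; rewrite patch_indic.
rewrite RintegralZl//; last first.
  have := bounded_integrable mu mB (mg l) (gM l).
  move/integrable_mkcond => /(_ mB); rewrite restrict_EFin.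
  by [].
rewrite -Rintegral_mkcond -Rintegral_mkcond Rintegral_cst// /s; ring.
Qed.

Let decoupled_add (h1 h2 : X -> R) : decoupled h1 -> decoupled h2 ->
  decoupled (fun x => h1 x + h2 x).
Proof.
move=> [mh1 b1 c1] [mh2 b2 c2]; split.
- exact: measurable_funD.
- case: b1 => C1 h1C; case: b2 => C2 h2C; exists (C1 + C2) => x.
  by apply: le_trans (ler_normD _ _) _; exact: lerD.
rewrite -[X in _ --> X](addr0 0).
rewrite (_ : (fun l => _) = (fun l =>
  (Rintegral mu setT (fun x => g l x * h1 x) -
    Rintegral mu setT (g l) * Rintegral mu setT h1) +
  (Rintegral mu setT (fun x => g l x * h2 x) -
    Rintegral mu setT (g l) * Rintegral mu setT h2))); first exact: cvgD.
apply/funext => l.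
have -> : (fun x => g l x * (h1 x + h2 x)) = (fun x => g l x * h1 x + g l x * h2 x).
  by apply/funext => x; rewrite mulrDr.
rewrite RintegralD//; last 2 first.
- by case: b1 => C1 h1C; exact: bounded_integrable h1C.
- by case: b2 => C2 h2C; exact: bounded_integrable h2C.
rewrite (RintegralD measurableT (gh_integrable l mh1 b1) (gh_integrable l mh2 b2)).
by ring.
Qed.

Import HBSimple.

Let decoupled_sfun (h : {sfun X >-> R}) : decoupled h.
Proof.
rewrite (_ : (h : X -> R) = (fun x => \sum_(y <- finmap.enum_fset (fset_set (range h)))
    y * \1_(h @^-1` [set y]) x)); last first.
  by apply/funext => x; rewrite fimfunE fsbig_finite.
elim: (finmap.enum_fset _) => [|y r IH].
  (* The empty sum is written as a multiple of an indicator, so that the base case is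
     [decoupled_indic] again. *)
  rewrite (_ : (fun x => _) = (fun x => 0 * \1_(@set0 X) x)); first exact: decoupled_indic.
  by apply/funext => x; rewrite big_nil mul0r.
rewrite (_ : (fun x => _) = (fun x => y * \1_(h @^-1` [set y]) x +
    \sum_(z <- r) z * \1_(h @^-1` [set z]) x)); last first.
  by apply/funext => x; rewrite big_cons.
apply: decoupled_add => //; apply: decoupled_indic.
by rewrite -[X in measurable X]setTI; exact: measurable_funP.
Qed.

(** The density of [k] is approximated in L1 by simple functions; as all [g l] are bounded by [M],
    the resulting error is uniform in [l]. *)
Lemma asymp_invariant_Rintegral (k : probability X R) : abs_cont k mu ->
  Rintegral k setT (g l) - Rintegral mu setT (g l) @[l --> \oo] --> 0.
Proof.
move=> kmu.
have kd : k `<< mu by apply/null_content_dominatesP => B mB; exact: kmu.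
pose D := Radon_Nikodym (charge_of_finite_measure k) mu.
have Dint : mu.-integrable setT D by exact: Radon_Nikodym_integrable.
pose D' := fine \o D.
have DE : D = EFin \o D'.
  by apply/funext => x; rewrite /D' /= fineK// Radon_Nikodym_fin_num.
have mD' : measurable_fun setT D'.
  by apply: measurableT_comp => //; exact: measurable_int Dint.
have kE l : Rintegral k setT (g l) = Rintegral mu setT (fun x => g l x * D' x).
  rewrite /Rintegral -(Radon_Nikodym_change_of_variables kd)//; last first.
    exact: bounded_integrable (gM l).
  by congr fine; apply: eq_integral => x _; rewrite -/D DE -EFinM.
have k1 : fine (k setT) = 1 by rewrite probability_setT.
have D1 : Rintegral mu setT D' = 1.
  rewrite /Rintegral -[X in integral _ _ X]/(EFin \o D') -DE.
  by rewrite -Radon_Nikodym_integral//; exact: k1.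
have [h_ [ih _ hD]] := approximation_sfun_integrable measurableT Dint.
have iD : mu.-integrable setT (EFin \o D') by rewrite -DE.
have iDh n : mu.-integrable setT (EFin \o (fun x => D' x - h_ n x)).
  by have := integrableB measurableT iD (ih n).
(* Replacing the density by [h_ n] costs the bound on [b] times their L1 distance. This serves both
   for [g l] and for the constant 1. *)
have close n (b : X -> R) (C : R) : measurable_fun setT b ->
    (forall x, `|b x| <= C) ->
    `|Rintegral mu setT (fun x => b x * D' x) -
      Rintegral mu setT (fun x => b x * h_ n x)| <=
    C * Rintegral mu setT (fun x => `|D' x - h_ n x|).
  move=> mb bC.
  have bint (f : X -> R) : mu.-integrable setT (EFin \o f) ->
      mu.-integrable setT (EFin \o (fun x => b x * f x)).
    move=> fint; apply: (integrableMr measurableT mb _ fint).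
    exists C; split; first exact: num_real.
    by move=> y Cy x _; exact: le_trans (bC x) (ltW Cy).
  have aint : mu.-integrable setT (EFin \o (fun x => `|D' x - h_ n x|)).
    by have := integrable_abse (iDh n).
  rewrite -RintegralB//; [|exact: bint|exact: bint].
  under eq_Rintegral do rewrite -mulrBr.
  apply: le_trans (le_normr_Rintegral measurableT (bint _ (iDh n))) _.
  rewrite -RintegralZl//; apply: le_Rintegral => //.
  - by have := integrable_abse (bint _ (iDh n)).
  - by have := integrableZl measurableT C aint.
  - by move=> x _; rewrite normrM ler_wpM2r.
apply/cvgrPdist_le => e e0.
have M1 : 0 < M + 1 by exact: ltr_wpDl.
(* The L1 approximation contributes two errors of at most [e / 4], the decorrelation one of [e / 2];
   [M + 1] keeps the denominator positive when [M] is 0. *)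
have e1 : 0 < e / (4 * (M + 1)) by rewrite divr_gt0// mulr_gt0.
have [n hn] : exists n, Rintegral mu setT (fun x => `|D' x - h_ n x|) <= e / (4 * (M + 1)).
  have /fine_cvgP[_ /cvgrPdist_le/(_ _ e1)] := hD.
  move=> /filter_ex[n]; rewrite sub0r normrN => hn; exists n.
  by apply: le_trans hn; rewrite DE; exact: ler_norm.
have [_ _ /cvgrPdist_le/(_ (e / 2))] := decoupled_sfun (h_ n).
rewrite divr_gt0// => /(_ isT) hcv; near=> l.
have hl : `|0 - (Rintegral mu setT (fun x => g l x * h_ n x) -
    Rintegral mu setT (g l) * Rintegral mu setT (h_ n))| <= e / 2.
  by near: l.
have c1 := close n (g l) M (mg l) (gM l).
(* As the density integrates to 1, this bounds the distance from 1 to the integral of [h_ n]. *)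
have : `|Rintegral mu setT (fun x => 1 * D' x) -
      Rintegral mu setT (fun x => 1 * h_ n x)| <=
    1 * Rintegral mu setT (fun x => `|D' x - h_ n x|).
  by apply: (close n (cst 1) 1) => // x; rewrite /= normr1.
under eq_Rintegral do rewrite mul1r.
under [X in _ - X]eq_Rintegral do rewrite mul1r.
rewrite D1 mul1r => c2; have := igM l.
move: hl c1 c2 hn; rewrite kE.
set I1 := Rintegral mu setT (fun x => g l x * D' x).
set c := Rintegral mu setT (g l).
set J := Rintegral mu setT (fun x => g l x * h_ n x).
set m := Rintegral mu setT (h_ n).
set q := Rintegral mu setT (fun x => `|D' x - h_ n x|) => hl c1 c2 hn cM.
have -> : 0 - (I1 - c) = - (I1 - J) + (0 - (J - c * m)) + c * (1 - m) by ring.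
apply: le_trans (ler_normD _ _) _; apply: le_trans (lerD (ler_normD _ _) (lexx _)) _.
rewrite normrN normrM.
have q0 : 0 <= q by exact: Rintegral_ge0.
have : `|c| * `|1 - m| <= M * q by rewrite ler_pM.
have : M * q <= e / 4.
  apply: le_trans (_ : (M + 1) * (e / (4 * (M + 1))) <= _).
    by rewrite ler_pM// lerDl.
  by rewrite le_eqVlt; apply/orP; left; apply/eqP; field; rewrite gt_eqF.
lra.
Unshelve. all: by end_near. Qed.

End asymptotically_invariant.

(** * Null sets and total variation *)

Section null_sets.
Context {R : realType} {d : measure_display} {X : measurableType d}.
Import HBNNSimple.

(* [f] need not be measurable: the integral is a supremum over simple functions,
   and these may be cut off outside [Y]. *)
Lemma integral_conull (k : {measure set X -> \bar R}) (Y : set X) (f : X -> \bar R) :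
  measurable Y -> k (~` Y) = 0%E ->
  (\int[k]_x f x = \int[k]_(x in Y) f x)%E.
Proof.
move=> mY kY.
have key (p q : X -> \bar R) : (forall x, 0 <= p x)%E -> (forall x, 0 <= q x)%E ->
    (forall x, Y x -> p x = q x) ->
    (ereal_sup [set sintegral k h |
      h in [set h : {nnsfun X >-> R} | forall x, ((h x)%:E <= p x)%E]] <=
    ereal_sup [set sintegral k h |
      h in [set h : {nnsfun X >-> R} | forall x, ((h x)%:E <= q x)%E]])%E.
  move=> p0 q0 pq; apply: ge_ereal_sup => _ [h /= hp <-].
  pose h' : {nnsfun X >-> R} := mul_nnsfun h (indic_nnsfun R mY).
  have h'E x : h' x = h x * \1_Y x by [].
  have -> : sintegral k h = sintegral k h'.
    rewrite /sintegral; apply: eq_fsbigr => r _.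
    (* The level set of 0 may change, but it enters with weight 0. *)
    have [->|r0] := eqVneq r 0; first by rewrite !mul0e.
    congr (_ * _)%E.
    have mh : measurable (h @^-1` [set r]).
      by rewrite -[X in measurable X]setTI; exact: measurable_funP.
    have -> : h' @^-1` [set r] = h @^-1` [set r] `&` Y.
      apply/seteqP; split => x; rewrite /preimage /mkset h'E indicE.
        have [/set_mem Yx|_] := boolP (x \in Y); rewrite ?mulr1 ?mulr0//.
        by move=> r0'; rewrite r0' eqxx in r0.
      by move=> [hx Yx]; rewrite mem_set// mulr1.
    rewrite (measureDI k mh mY) [X in (X + _)%E](_ : _ = 0)%E ?add0e//.
    apply/eqP; rewrite eq_le measure_ge0 andbT -kY; apply: le_measure; rewrite ?inE.
    - exact: measurableD.
    - exact: measurableC.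
    - by move=> x [].
  apply: ereal_sup_ubound; exists h' => // x; rewrite h'E indicE.
  by have [/set_mem Yx|_] := boolP (x \in Y); rewrite ?mulr1 ?mulr0// -pq.
have res x : Y x -> (f \_ setT) x = (f \_ Y) x.
  by move=> Yx; rewrite !patchE !mem_set.
have pos x : Y x -> ((f \_ setT)^\+ x = (f \_ Y)^\+ x)%E.
  by move=> Yx; rewrite !funeposE res.
have neg x : Y x -> ((f \_ setT)^\- x = (f \_ Y)^\- x)%E.
  by move=> Yx; rewrite !funenegE res.
rewrite /integral; congr (_ - _)%E; apply/eqP; rewrite eq_le; apply/andP; split.
- exact: key.
- by apply: key => // x Yx; rewrite pos.
- exact: key.
- by apply: key => // x Yx; rewrite neg.
Qed.

(** Trades a function controlled only on [Y] for one that is 0 elsewhere and may be measurable on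
    the whole space. *)
Lemma Rintegral_conull (k : {measure set X -> \bar R}) (Y : set X) (f : X -> R) :
  measurable Y -> k (~` Y) = 0%E ->
  Rintegral k setT f = Rintegral k setT (f \_ Y).
Proof.
by move=> mY kY; rewrite -Rintegral_mkcond /Rintegral (integral_conull _ mY kY).
Qed.

End null_sets.

Section total_variation.
Context {R : realType} {d : measure_display} {X : measurableType d}.

(** The factor 2 in [dP] gives the bound [e / 2] on every measurable set, hence on each part of the
    Jordan decomposition of [k - k']; the two masses add up to at most [e]. *)
Lemma le_dist_Rintegral_dP (k k' : probability X R) (g : X -> R) (M e : R) :
  measurable_fun setT g -> 0 <= M -> (forall x, `|g x| <= M) ->
  (dP k k' <= e%:E)%E ->
  `|Rintegral k setT g - Rintegral k' setT g| <= M * e.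
Proof.
move=> mg M0 gM ke.
have dist B : measurable B -> `|fine (k B) - fine (k' B)| <= e / 2.
  move=> mB; rewrite ler_pdivlMr// mulrC -lee_fin EFinM; apply: le_trans ke.
  rewrite /dP lee_pmul2l//; apply: ereal_sup_ubound; exists B => //.
  by rewrite -[in LHS](fineK (fin_num_measure k _ mB)) -[in LHS](fineK (fin_num_measure k' _ mB)).
pose s := cadd (charge_of_finite_measure k) (copp (charge_of_finite_measure k')).
have [P [N PN]] := Hahn_decomposition s.
have mP : measurable P by case: PN => -[].
have mN : measurable N by case: PN => _ [].
pose jp : {finite_measure set X -> \bar R} := jordan_pos PN.
pose jn : {finite_measure set X -> \bar R} := jordan_neg PN.
have sE B : measurable B -> (k B - k' B = jp B - jn B)%E.
  by move=> mB; have := jordan_decomp PN mB; rewrite /cadd /= cscaleN1.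
have jpT : fine (jp setT) <= e / 2.
  have -> : jp setT = (k P - k' P)%E.
    rewrite -[jp setT]/(jordan_pos PN setT) jordan_posE cjordan_posE.
    by rewrite /crestr0 mem_set// /crestr setTI.
  by rewrite fineB ?fin_num_measure//; apply: le_trans (ler_norm _) (dist _ mP).
have jnT : fine (jn setT) <= e / 2.
  have -> : jn setT = (- (k N - k' N))%E.
    rewrite -[jn setT]/(jordan_neg PN setT) jordan_negE cjordan_negE.
    by rewrite /crestr0 mem_set// /crestr setTI.
  rewrite fineN fineB ?fin_num_measure//; apply: le_trans (ler_norm _) _.
  by rewrite normrN; exact: dist.
have ig (m : {finite_measure set X -> \bar R}) : m.-integrable setT (EFin \o g).
  exact: bounded_integrable gM.
(* The decomposition is rearranged into [k + jn = k' + jp], an identity of positive measures, for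
   which integrals add. *)
have eqi : (\int[k]_x (g x)%:E + \int[jn]_x (g x)%:E =
            \int[k']_x (g x)%:E + \int[jp]_x (g x)%:E)%E.
  rewrite -!integral_measure_add//; try exact: ig.
  apply: eq_measure_integral => B mB _.
  transitivity (k B + jn B)%E; first exact: measure_addE.
  transitivity (k' B + jp B)%E; last exact/esym/measure_addE.
  move: (sE B mB) => /eqP.
  rewrite -(fineK (fin_num_measure k _ mB)) -(fineK (fin_num_measure k' _ mB)).
  rewrite -(fineK (fin_num_measure jn _ mB)) -(fineK (fin_num_measure jp _ mB)).
  rewrite -!EFinB -!EFinD eqe => /eqP h; congr EFin; lra.
have fi (m : {finite_measure set X -> \bar R}) : (\int[m]_x (g x)%:E)%E \is a fin_num.
  exact: (integrable_fin_num measurableT (ig m)).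
have : Rintegral k setT g + Rintegral jn setT g =
       Rintegral k' setT g + Rintegral jp setT g.
  by rewrite /Rintegral -!fineD ?fi// eqi.
have := le_norm_bounded_Rintegral jp measurableT mg gM.
have := le_norm_bounded_Rintegral jn measurableT mg gM.
have : M * fine (jp setT) <= M * (e / 2) by rewrite ler_wpM2l.
have : M * fine (jn setT) <= M * (e / 2) by rewrite ler_wpM2l.
by rewrite !ler_norml; lra.
Qed.

End total_variation.

(** * Uniformity over compact families *)

Section compact_uniformity.
Context {R : realType} {d : measure_display} {X : measurableType d}.
Variables (mu : probability X R) (K : set (probability X R)).
Hypothesis cK : Pcompact mu K.
Variables (g : nat -> X -> R) (M : R).
Hypotheses (mg : forall l, measurable_fun setT (g l)) (gM : forall l x, `|g l x| <= M).
Hypothesis cvgK : forall k, abs_cont k mu ->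
  Rintegral k setT (g l) - Rintegral mu setT (g l) @[l --> \oo] --> 0.

Lemma compact_uniform_cvg (k : nat -> probability X R) : (forall l, K (k l)) ->
  Rintegral (k l) setT (g l) - Rintegral mu setT (g l) @[l --> \oo] --> 0.
Proof.
move=> kK; have [Kmu cov] := cK.
have M0 : 0 <= M.
  apply: le_trans (_ : `|Rintegral mu setT (g 0%N)| <= _) => //.
  have := le_norm_bounded_Rintegral mu measurableT (mg 0%N) (gM 0%N).
  suff -> : fine (mu setT) = 1 by rewrite mulr1.
  by rewrite probability_setT.
have M1 : 0 < M + 1 by exact: ltr_wpDl.
apply/cvgrPdist_le => e e0.
(* The slack [r], uniform in [l], is what makes [U n] open. The sets grow with [n], so a finite
   subcover yields a single threshold. *)
pose U (n : nat) : set (probability X R) := [set nu | exists2 r : R, 0 < r &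
  forall l, (n <= l)%N ->
    `|Rintegral nu setT (g l) - Rintegral mu setT (g l)| + r <= e].
have Uopen n : Popen mu (U n).
  (* Within this radius integrals move by at most [r / 2], so half of the slack survives. *)
  move=> nu [r r0 h] _; exists (r / (2 * (M + 1))).
    by rewrite divr_gt0// mulr_gt0.
  move=> nu' _ /ltW nu'r; exists (r / 2); first by rewrite divr_gt0.
  move=> l nl; have := le_dist_Rintegral_dP (mg l) M0 (gM l) nu'r.
  have : M * (r / (2 * (M + 1))) <= r / 2.
    apply: le_trans (_ : (M + 1) * (r / (2 * (M + 1))) <= _).
      by rewrite ler_wpM2r ?lerDl// divr_ge0 ?ltW// mulr_gt0.
    by rewrite le_eqVlt; apply/orP; left; apply/eqP; field; rewrite gt_eqF.
  have := h l nl.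
  have := ler_distD (Rintegral nu setT (g l)) (Rintegral nu' setT (g l)) (Rintegral mu setT (g l)).
  rewrite (distrC (Rintegral nu' setT (g l)) (Rintegral nu setT (g l))); lra.
have Kcov : K `<=` \bigcup_n U n.
  move=> nu Knu; have e2 : 0 < e / 2 by rewrite divr_gt0.
  have /cvgrPdist_le/(_ _ e2)[n _ hn] := cvgK (Kmu _ Knu).
  exists n => //; exists (e / 2) => // l nl; have := hn l nl.
  by rewrite sub0r normrN; lra.
have [J Jfin KJ] := cov nat U Uopen Kcov.
have [n Jn] : exists n, forall j, J j -> (j <= n)%N.
  have /finite_seqP[r ->] := Jfin; exists (\max_(i <- r) i)%N => j /= jr.
  exact: leq_bigmax_seq.
near=> l; have [j Jj [r r0 /(_ l)]] := KJ _ (kK l).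
rewrite sub0r normrN => h.
have : (j <= l)%N by apply: leq_trans (Jn _ Jj) _; near: l; exact: nbhs_infty_ge.
by move/h; lra.
Unshelve. all: by end_near. Qed.

End compact_uniformity.

(** * The first return map *)

Section return_map.
Context {R : realType} {d : measure_display} {X : measurableType d}.
Variables (mu : probability X R) (T : X -> X) (A : set X).
Hypotheses (muT : measure_preserving mu T) (mA : measurable A).

(** Time 0 is left out because return times start at 1: the point itself may lie in [A]. [lt_phiE]
    links this set to [phi]. *)
Definition no_hit (t : nat) : set X :=
  [set x | forall m, (0 < m <= t)%N -> ~ A (iter m T x)].

Lemma measurable_no_hit t : measurable (no_hit t).
Proof.
rewrite (_ : no_hit t = \bigcap_(m in [set m | (0 < m <= t)%N]) ~` (iter m T @^-1` A)) //.
apply: bigcap_measurableType => m _; apply: measurableC.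
exact: (measurable_preimage_iter muT).
Qed.

Lemma recurrent_hit x : recurrent T A x ->
  exists n, (0 < n)%N && `[< A (iter n T x) >].
Proof.
by move=> /recurrentP/(_ 1%N)[n n0 An]; exists n; rewrite n0; apply/asboolP.
Qed.

Lemma first_returnP x : recurrent T A x ->
  exists n, [/\ first_return T A x = n.+1, A (iter n.+1 T x) & no_hit n x].
Proof.
move=> rx; rewrite /first_return; case: pselect => [h|]; last by move/(_ (recurrent_hit rx)).
case: ex_minnP => -[//|n] /= /asboolP An nmin; exists n; split => //.
move=> m /andP[m0 mn] Am; have := nmin m; rewrite m0 /= => /(_ (asboolT Am)).
by rewrite ltnNge mn.
Qed.

Lemma first_return_eq x n : A (iter n.+1 T x) -> no_hit n x ->
  first_return T A x = n.+1.
Proof.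
move=> An nh; rewrite /first_return; case: pselect => [h|h]; last first.
  by exfalso; apply: h; exists n.+1; exact/asboolP.
case: ex_minnP => m /andP[m0 /asboolP Am] mmin; apply/eqP; rewrite eqn_leq.
rewrite mmin ?asboolT//=; rewrite ltnNge; apply/negP => mn.
by apply: (nh m) => //; rewrite m0.
Qed.

(** Without a visit up to time [t], the next visit after [t] is the first return of [x]: both points
    reach it, one of them [t] steps sooner. *)
Lemma TA_iter t x : recurrent T A x -> no_hit t x ->
  TA T A (iter t T x) = TA T A x.
Proof.
move=> rx nht; have [n [frn An nhn]] := first_returnP rx.
have tn : (t <= n)%N.
  by rewrite leqNgt; apply/negP => nt; apply: (nht n.+1).
have E : first_return T A (iter t T x) = (n - t).+1.
  apply: first_return_eq; first by rewrite -iterD -subSn// subnK// ltnW.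
  move=> m /andP[m0 mt]; rewrite -iterD; apply: nhn.
  by rewrite addn_gt0 m0/= addnC -leq_subRL.
by rewrite /TA E frn -iterD -subSn// subnK// ltnW.
Qed.

Lemma recurrent_TA x : recurrent T A x -> recurrent T A (TA T A x).
Proof. by move=> rx; rewrite /TA recurrent_iter. Qed.

Lemma TA_in x : recurrent T A x -> A (TA T A x).
Proof. by move=> rx; rewrite /TA; have [n [-> ]] := first_returnP rx. Qed.

Lemma recurrent_iter_TA j x : recurrent T A x -> recurrent T A (iter j (TA T A) x).
Proof. by elim: j => //= j IH /IH; exact: recurrent_TA. Qed.

(** The recurrent set splits into countably many pieces according to the return time, and on each of
    them [TA] is a fixed iterate of [T]. *)
Lemma measurable_preimage_TA C : measurable C ->
  measurable (recurrent T A `&` TA T A @^-1` C).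
Proof.
move=> mC; have mY := measurable_recurrent muT mA.
rewrite (_ : _ `&` _ = recurrent T A `&`
  \bigcup_n ((iter n.+1 T @^-1` A) `&` no_hit n `&` (iter n.+1 T @^-1` C))).
  apply: measurableI => //; apply: bigcup_measurable => n _.
  apply: measurableI; last exact: (measurable_preimage_iter muT).
  apply: measurableI; first exact: (measurable_preimage_iter muT).
  exact: measurable_no_hit.
apply/seteqP; split => x [rx].
  rewrite /preimage /mkset /TA; have [n [-> An nh]] := first_returnP rx.
  by move=> Cn; split => //; exists n.
by move=> [n _ [[An nh] Cn]]; split => //; rewrite /preimage /mkset /TA (first_return_eq An nh).
Qed.

Lemma measurable_preimage_iter_TA j C : measurable C ->
  measurable (recurrent T A `&` iter j (TA T A) @^-1` C).
Proof.
move=> mC; elim: j => [|j IH].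
  by apply: measurableI => //; exact: (measurable_recurrent muT).
rewrite (_ : _ `&` _ = recurrent T A `&`
    TA T A @^-1` (recurrent T A `&` iter j (TA T A) @^-1` C)).
  exact: measurable_preimage_TA.
have E x : iter j.+1 (TA T A) x = iter j (TA T A) (TA T A x) by rewrite iterSr.
apply/seteqP; split => x [rx].
  move=> Cx; split => //; split; first exact: recurrent_TA.
  by rewrite /preimage /mkset -E.
by move=> [_ Cx]; split => //; rewrite /preimage /mkset E.
Qed.

(** Every coordinate is read after at least one application of [TA], whose values at the two points
    already agree. *)
Lemma local_process_iter (F : Type) (psi : X -> F) t x : recurrent T A x -> no_hit t x ->
  local_process T A psi (iter t T x) = local_process T A psi x.
Proof.
by move=> rx nh; apply/funext => j; rewrite /local_process !iterSr TA_iter.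
Qed.

(** On the recurrent set the iterates of [TA] land in [A], where [psi] is known to be measurable. *)
Lemma measurable_local_coord (F : topologicalType) (psi : X -> F) j (U : set F) :
  borel_meas_on A psi -> open U ->
  measurable (recurrent T A `&` (fun x => local_process T A psi x j) @^-1` U).
Proof.
move=> mpsi oU.
rewrite (_ : _ `&` _ = recurrent T A `&` iter j.+1 (TA T A) @^-1` (A `&` psi @^-1` U)).
  by apply: measurable_preimage_iter_TA; exact: mpsi.
apply/seteqP; split => x [rx]; rewrite /preimage /mkset /local_process.
  by split => //; split => //; rewrite iterS; apply/TA_in/recurrent_iter_TA.
by move=> [].
Qed.

Lemma lt_phiE (t : nat) x : ((t%:R : R)%:E < @phi R _ _ T A x)%E <-> no_hit t x.
Proof.
rewrite /phi; case: asboolP => h; last first.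
  split=> _; last exact: ltry.
  by move=> m /andP[m0 _] Am; apply: h; exists m; rewrite m0; exact/asboolP.
rewrite lte_fin ltr_nat /first_return; case: pselect => // h'.
case: ex_minnP => n /andP[n0 /asboolP An] nmin; split => [tn m /andP[m0 mt] Am|nh].
  have := nmin m; rewrite m0 asboolT// => /(_ isT); rewrite leqNgt.
  by rewrite (leq_ltn_trans mt tn).
by rewrite ltnNge; apply/negP => nt; apply: (nh n) => //; rewrite n0.
Qed.

End return_map.

(** * Measurability of continuous functions of a process *)

Section discrete_measurability.
Context {d : measure_display} {X : measurableType d} (Y : set X).
Hypothesis mY : measurable Y.

(** With [s] a finite net and [U c] a neighbourhood of [c], the index is a discrete code for a net
    point near [Z x]. *)
Lemma measurable_find (F : Type) (Z : X -> F) (U : F -> set F) (s : seq F) (i : nat) :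
  (forall c, measurable (Y `&` Z @^-1` U c)) ->
  measurable (Y `&` [set x | find (fun c => `[< U c (Z x) >]) s = i]).
Proof.
move=> mU; elim: s i => [|c s IH] i.
  case: i => [|i]; first by rewrite (_ : [set x | _] = setT) ?setIT//; exact/seteqP.
  by rewrite (_ : [set x | _] = set0) ?setI0//; apply/seteqP; split.
case: i => [|i].
  rewrite (_ : [set x | _] = Z @^-1` U c)//; apply/seteqP; split => x /=.
    by case: asboolP.
  by move=> Ux; rewrite asboolT.
rewrite (_ : _ `&` _ = (Y `&` [set x | find (fun c => `[< U c (Z x) >]) s = i])
    `\` (Y `&` Z @^-1` U c)); first exact: measurableD.
apply/seteqP; split => x /=.
  by move=> [Yx]; case: asboolP => // nU [fi]; split => // -[].
move=> [[Yx fi] nU]; split => //; rewrite asboolF ?fi// => Ux.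
exact: nU.
Qed.

Lemma measurable_map (k : nat -> X -> nat) (r s : seq nat) :
  (forall j i, measurable (Y `&` [set x | k j x = i])) ->
  measurable (Y `&` [set x | [seq k j x | j <- r] = s]).
Proof.
move=> mk; elim: r s => [|j r IH] [|i s] /=.
- by rewrite (_ : [set x | _] = setT) ?setIT//; exact/seteqP.
- by rewrite (_ : [set x | _] = set0) ?setI0//; apply/seteqP; split.
- by rewrite (_ : [set x | _] = set0) ?setI0//; apply/seteqP; split.
rewrite (_ : _ `&` _ = (Y `&` [set x | k j x = i]) `&`
    (Y `&` [set x | [seq k j x | j <- r] = s])); first exact: measurableI.
apply/seteqP; split => x /=; first by move=> [Yx [-> ->]].
by move=> [[Yx ->] [_ ->]].
Qed.

(** Finite sequences of naturals are countable, so each preimage is a countable union of level sets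
    of the code. *)
Lemma measurable_fun_map (R : realType) (k : nat -> X -> nat) (r : seq nat)
    (G : seq nat -> R) :
  (forall j i, measurable (Y `&` [set x | k j x = i])) ->
  measurable_fun Y (fun x => G [seq k j x | j <- r]).
Proof.
move=> mk _ B mB.
rewrite (_ : _ `&` _ = \bigcup_s (if `[< B (G s) >] then
    Y `&` [set x | [seq k j x | j <- r] = s] else set0)).
  apply: countable_bigcupT_measurable => [|s]; first exact: countableP.
  by case: ifP => // _; exact: measurable_map.
apply/seteqP; split => x.
  move=> [Yx Bx]; exists [seq k j x | j <- r] => //.
  by rewrite asboolT.
by move=> [s _]; case: asboolP => // Bs [Yx /= sE]; split => //=; rewrite sE.
Qed.

End discrete_measurability.

Section process_measurability.
Context {R : realType} {F : metricType R}.
Context {d : measure_display} {X : measurableType d} (Y : set X).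
Hypotheses (mY : measurable Y) (cF : compact [set: F]).

(** Interiors of balls are taken because measurability of the process is given for preimages of open
    sets. *)
Lemma compact_finite_net (e : R) : 0 < e ->
  exists s : seq F, forall y, exists2 c, c \in s & (ball c e)° y.
Proof.
move=> e0.
(* The filter of properties shared by all sufficiently large finite lists, to which the
   near-covering form of compactness applies. *)
pose G : set_system (seq F) :=
  [set S : set (seq F) | exists s0 : seq F, forall s : seq F, {subset s0 <= s} -> S s].
have GF : Filter G.
  split; first by exists [::].
  - move=> P Q [s1 P1] [s2 Q2]; exists (s1 ++ s2) => s s12.
    by split; [apply: P1|apply: Q2] => c cs; apply: s12; rewrite mem_cat cs ?orbT.
  - by move=> P Q PQ [s1 P1]; exists s1 => s /P1/PQ.
have /compact_near_coveringP ncF := cF.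
have [|s sP] := ncF _ G (fun s y => exists2 c, c \in s & (ball c e)° y) GF _.
  move=> y _; exists ((ball y e)°, [set s : seq F | y \in s]) => /=.
    split; first by apply: nbhs_interior; exact: nbhsx_ballx.
    by exists [:: y] => s; apply; rewrite mem_head.
  by move=> [y' s] /= [yy' ys]; exists y.
by exists s => y; exact: sP.
Qed.

(* The coordinates are replaced by nearby points of finite nets, so that the
   approximations of [f \o Z] take countably many values. *)
Lemma measurable_continuous_process (Z : X -> {ptws nat -> F})
    (f : {ptws nat -> F} -> R) :
  (forall j (U : set F), open U -> measurable (Y `&` (fun x => Z x j) @^-1` U)) ->
  continuous f -> measurable_fun Y (f \o Z).
Proof.
move=> mZ cf.
have [[x0 _]|Y0] := pselect (Y !=set0); last first.
  have -> : Y = set0 by rewrite -subset0 => x Yx; apply: Y0; exists x.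
  exact: measurable_fun_set0.
pose z0 : F := Z x0 0%N.
pose e (n : nat) : R := n.+1%:R^-1.
have e_gt0 n : 0 < e n by rewrite invr_gt0.
have /choice[s sP] : forall n, exists s : seq F,
    forall y, exists2 c, c \in s & (ball c (e n))° y.
  by move=> n; exact: compact_finite_net.
pose k n j x := find (fun c => `[< (ball c (e n))° (Z x j) >]) (s n).
(* Coordinates from [n] on are frozen at [z0]; this is harmless in the product topology, since each
   fixed coordinate is frozen for finitely many [n] only. *)
pose G n (t : seq nat) : R :=
  f (fun j => if (j < n)%N then nth z0 (s n) (nth 0%N t j) else z0).
apply: (@measurable_fun_cvg _ _ _ _
    (fun n x => G n [seq k n j x | j <- iota 0 n])).
  move=> n; apply: measurable_fun_map => // j i.
  apply: (@measurable_find _ _ _ mY _ (fun x => Z x j) (fun c => (ball c (e n))°)).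
  by move=> c; apply: mZ; exact: open_interior.
move=> x Yx.
pose z n : {ptws nat -> F} := fun j =>
  if (j < n)%N then nth z0 (s n) (nth 0%N [seq k n i x | i <- iota 0 n] j) else z0.
suff zZ : z n @[n --> \oo] --> Z x.
  exact: (continuous_cvg _ (cf (Z x)) zZ).
apply/pointwise_cvgP => t; suff : z n t @[n --> \oo] --> Z x t by [].
apply/cvg_ballP => r r0.
near=> n.
have tn : (t < n)%N by near: n; exact: nbhs_infty_gt.
have er : e n < r by near: n; exact: (near_infty_natSinv_lt (PosNum r0)).
rewrite /= /z tn (nth_map 0%N) ?size_iota// nth_iota// add0n.
apply: (le_ball (ltW er)); apply/ball_sym.
(* The net covers, so [find] succeeds and [nth] returns a net point close to [Z x t], not the
   default. *)
have : has (fun c => `[< (ball c (e n))° (Z x t) >]) (s n).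
  by have [c cs Uc] := sP n (Z x t); apply/hasP; exists c => //; exact/asboolP.
by move/(nth_find z0)/asboolP; exact: interior_subset.
Unshelve. all: by end_near. Qed.

End process_measurability.

(** * Comparison of the two sequences of laws *)

Section comparison.
Context {R : realType} {d : measure_display} {X : measurableType d}.
Variables (mu : probability X R) (T : X -> X).
Hypotheses (muT : measure_preserving mu T).

Lemma measurable_Ttau (tau : X -> nat) :
  measurable_fun setT tau -> measurable_fun setT (Ttau T tau).
Proof.
move=> mtau _ B mB.
rewrite (_ : _ `&` _ = \bigcup_n (tau @^-1` [set n] `&` iter n T @^-1` B)).
  apply: bigcup_measurable => n _; apply: measurableI.
    by rewrite -[X in measurable X]setTI; exact: mtau.
  exact: (measurable_preimage_iter muT).
by apply/seteqP; split => [x [_ Bx]|x [n _ [<- Bx]]]; [exists (tau x)|].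
Qed.

Lemma measurable_lt_phi (A : set X) (tau : X -> nat) :
  measurable A -> measurable_fun setT tau ->
  measurable [set x | (((tau x)%:R : R)%:E < @phi R _ _ T A x)%E].
Proof.
move=> mA mtau.
rewrite (_ : [set x | _] = \bigcup_n (tau @^-1` [set n] `&` no_hit T A n)).
  apply: bigcup_measurable => n _; apply: measurableI.
    by rewrite -[X in measurable X]setTI; exact: mtau.
  exact: (measurable_no_hit muT).
apply/seteqP; split => x /=; first by move=> /lt_phiE h; exists (tau x).
by move=> [n _ [/= tn h]]; apply/lt_phiE; rewrite tn.
Qed.

End comparison.

(** Stated for the difference of integrals, before any limit is taken, so that it serves both
    implications. *)
Lemma local_process_laws_merge (R : realType) (F : metricType R)
  (d : measure_display) (X : measurableType d) (mu : probability X R)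
  (T : X -> X) (A : nat -> set X) (psi : nat -> X -> F)
  (nu : nat -> probability X R) (tau : nat -> X -> nat)
  (K : set (probability X R)) (f : {ptws nat -> F} -> R) (M : R) :
  compact [set: F] ->
  measure_preserving mu T -> ergodic mu T ->
  (forall l, measurable (A l)) -> (forall l, (0 < mu (A l))%E) ->
  (fun l => mu (A l)) @ \oo --> 0%E ->
  (forall l, borel_meas_on (A l) (psi l)) ->
  (forall l, abs_cont (nu l) mu) ->
  (forall l, measurable_fun setT (tau l)) ->
  (fun l => nu l [set x | (((tau l x)%:R : R)%:E < @phi R _ _ T (A l) x)%E]) @ \oo --> 1%E ->
  Pcompact mu K ->
  (forall l, exists2 kappa, K kappa &
      forall B, measurable B -> kappa B = nu l (Ttau T (tau l) @^-1` B)) ->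
  continuous f -> (forall z, `|f z| <= M) ->
  Rintegral (nu l) setT (f \o local_process T (A l) (psi l)) -
  Rintegral mu setT (f \o local_process T (A l) (psi l)) @[l --> \oo] --> 0.
Proof.
move=> cF muT ergT mA A0 Acvg mpsi numu mtau taucvg cK hK cf fM.
pose Y l := recurrent T (A l).
have mY l : measurable (Y l) by exact: (measurable_recurrent muT).
have muY l : mu (~` Y l) = 0%E.
  rewrite probability_setC// (_ : mu (Y l) = 1%E) ?subee//.
  exact: (measure_recurrent muT).
pose Z l := local_process T (A l) (psi l).
(* Setting the function to 0 off the recurrent set makes it measurable on all of [X]; measures
   absolutely continuous with respect to [mu] do not see the change. *)
pose g l := (f \o Z l) \_ (Y l).
have mg l : measurable_fun setT (g l).
  apply/(measurable_restrictT _ (mY l)).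
  apply: (measurable_continuous_process (mY l) cF _ cf) => j U oU.
  exact: (measurable_local_coord muT).
have gM l x : `|g l x| <= M.
  rewrite /g patchE; case: ifP => _; first exact: fM.
  by rewrite normr0; exact: le_trans (fM (Z l x)).
have M0 : 0 <= M.
  have [x _] : exists x : X, True.
    apply: contrapT => h; have : mu setT = 0%E.
      rewrite (_ : setT = set0) ?measure0// -subset0 => x _.
      by apply: h; exists x.
    by rewrite probability_setT => /eqP; rewrite onee_eq0.
  exact: le_trans (gM 0%N x).
(* Off the recurrent set both values are 0, because the orbit never enters it. *)
have g_iter l t x : no_hit T (A l) t x -> g l (iter t T x) = g l x.
  move=> nh; rewrite /g !patchE.
  have [Yx|nYx] := pselect (Y l x).
    rewrite !mem_set//; last exact/recurrent_iter.
    by rewrite /= /Z local_process_iter.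
  by rewrite !memNset// => /recurrent_iter.
have Rg k l : abs_cont k mu ->
    Rintegral k setT (f \o Z l) = Rintegral k setT (g l).
  move=> kmu; apply: Rintegral_conull => //; apply: kmu => //.
  exact: measurableC.
have [kap kapP] : {kap : nat -> probability X R | forall l, K (kap l) /\
    forall B, measurable B -> kap l B = nu l (Ttau T (tau l) @^-1` B)}.
  have /choice[kap kapP] : forall l, exists kp, K kp /\
      forall B, measurable B -> kp B = nu l (Ttau T (tau l) @^-1` B).
    by move=> l; have [kp ? ?] := hK l; exists kp.
  by exists kap.
(* The exceptional set for [g l \o T = g l] consists of the points that hit [A l] at time 1; by
   invariance it is as small as [A l]. *)
have E0 : fine (mu (T @^-1` A l)) @[l --> \oo] --> 0.
  rewrite (_ : (fun l => _) = (fun l => fine (mu (A l)))); last first.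
    by apply/funext => l; rewrite muT.2.
  exact: (fine_cvg Acvg).
have mT : measurable_fun setT T by case: muT.
have mE l : measurable (T @^-1` A l) by rewrite -[X in measurable X]setTI; exact: mT.
have gE l x : ~ (T @^-1` A l) x -> g l (T x) = g l x.
  move=> nA; apply: (g_iter l 1%N) => -[//|[|//]] _; exact: nA.
have kcv := compact_uniform_cvg cK mg gM
  (fun k => asymp_invariant_Rintegral muT ergT mg gM mE E0 gE (k := k))
  (fun l => (kapP l).1).
pose S l := [set x | (((tau l x)%:R : R)%:E < @phi R _ _ T (A l) x)%E].
have mS l : measurable (S l) by exact: (measurable_lt_phi muT).
have ncv : Rintegral (nu l) setT (g l) - Rintegral (kap l) setT (g l) @[l --> \oo] --> 0.
  (* On [S l] the orbit has not hit [A l] by time [tau l x], so the shift leaves [g l] unchanged;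
     the complement has vanishing mass under [nu l]. *)
  apply: (@squeeze_norm0 _ _ (fun l => 2 * M * (1 - fine (nu l (S l))))); last first.
    rewrite -[X in _ --> X](mulr0 (2 * M)) -(subrr 1).
    apply: cvgMl_tmp; apply: cvgB; first exact: cvg_cst.
    exact: (fine_cvg taucvg).
  move=> l.
  have mTt := measurable_Ttau muT (mtau l).
  have mgT : measurable_fun setT (g l \o Ttau T (tau l)) by exact: measurableT_comp.
  have -> : Rintegral (kap l) setT (g l) =
      Rintegral (nu l) setT (g l \o Ttau T (tau l)).
    rewrite /Rintegral; congr fine.
    rewrite (eq_measure_integral (pushforward (nu l) (Ttau T (tau l)))); last first.
      by move=> C mC _; exact: (kapP l).2.
    rewrite integral_pushforward//; first by apply/measurable_EFinP; exact: mg.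
    rewrite preimage_setT; apply: (bounded_integrable _ measurableT mgT (M := M)).
    by move=> x; exact: gM.
  have <- : fine (nu l (~` S l)) = 1 - fine (nu l (S l)).
    by rewrite probability_setC// fineB ?fin_num_measure.
  apply: le_dist_Rintegral_off => //; first exact: measurableC.
    by move=> x; exact: gM.
  by move=> x /contrapT /lt_phiE nh; apply/esym/g_iter.
rewrite -(addr0 0).
rewrite (_ : (fun l => _) = (fun l =>
  (Rintegral (nu l) setT (g l) - Rintegral (kap l) setT (g l)) +
  (Rintegral (kap l) setT (g l) - Rintegral mu setT (g l)))).
  exact: cvgD.
by apply/funext => l; rewrite !Rg// addrA subrK.
Qed.

Theorem mainTheorem5 (R : realType) (F : metricType R)
  (d : measure_display) (X : measurableType d) (mu : probability X R)
  (T : X -> X) (A : nat -> set X) (psi : nat -> X -> F)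
  (nu : nat -> probability X R) (tau : nat -> X -> nat)
  (K : set (probability X R)) :
  compact [set: F] ->
  measure_preserving mu T -> ergodic mu T ->
  (forall l, measurable (A l)) -> (forall l, (0 < mu (A l))%E) ->
  (fun l => mu (A l)) @ \oo --> 0%E ->
  (forall l, borel_meas_on (A l) (psi l)) ->
  (forall l, abs_cont (nu l) mu) ->
  (forall l, measurable_fun setT (tau l)) ->
  (fun l => nu l [set x | (((tau l x)%:R : R)%:E < @phi R _ _ T (A l) x)%E]) @ \oo --> 1%E ->
  Pcompact mu K ->
  (forall l, exists2 kappa, K kappa &
      forall B, measurable B -> kappa B = nu l (Ttau T (tau l) @^-1` B)) ->
  forall (dO : measure_display) (Om : measurableType dO) (P : probability Om R)
         (Psi : Om -> {ptws nat -> F}),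
  (forall U : set {ptws nat -> F}, open U -> measurable (Psi @^-1` U)) ->
  (weak_cvg_law nu (fun l => local_process T (A l) (psi l)) P Psi <->
   weak_cvg_law (fun _ => mu) (fun l => local_process T (A l) (psi l)) P Psi).
Proof.
move=> cF muT ergT mA A0 Acvg mpsi numu mtau taucvg cK hK dO Om P Psi _.
have merge (f : {ptws nat -> F} -> R) M := @local_process_laws_merge
  R F d X mu T A psi nu tau K f M cF muT ergT mA A0 Acvg mpsi numu mtau taucvg cK hK.
pose a f l := Rintegral (nu l) setT (f \o local_process T (A l) (psi l)).
pose b f l := Rintegral mu setT (f \o local_process T (A l) (psi l)).
split=> wcv f cf [M fM].
  (* Either integral is the other one corrected by the vanishing difference. *)
  have E : b f = (fun l => a f l - (a f l - b f l)).
    by apply/funext => l; rewrite subKr.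
  have := cvgB (wcv f cf (ex_intro _ M fM)) (merge f M cf fM).
  by rewrite subr0 -[X in _ -> X]/(b f @ \oo --> _) E; exact.
have E : a f = (fun l => b f l + (a f l - b f l)).
  by apply/funext => l; rewrite addrC subrK.
have := cvgD (wcv f cf (ex_intro _ M fM)) (merge f M cf fM).
by rewrite addr0 -[X in _ -> X]/(a f @ \oo --> _) E; exact.
Qed.
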